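(* For each $M \in \{0, 2, 4, 5, 10, 11, 12, 13, 14, 15, 29, 35, 43, 51, 76, 128, 192, 200\}$, the equivalence class of Rule $M$ is vN-regular; that is, every elementary cellular automaton equivalent to Rule $M$ is a vN-regular element of $\mathrm{CA}(\mathbb{Z};\{0,1\})$.
   Context: Let $A=\{0,1\}$. Functions are applied on the right, and $\tau\sigma$ means first $\tau$, then $\sigma$. A cellular automaton over $A^{\mathbb{Z}}$ is a map $\tau:A^{\mathbb{Z}}\to A^{\mathbb{Z}}$ for which there exist a finite $S\subseteq\mathbb{Z}$ (memory set) and $\mu:A^S\to A$ (local function) such that for all $x\in A^{\mathbb{Z}}$, $i\in\mathbb{Z}$, $(i)(x)\tau$ is the value of $\mu$ at the map $s\mapsto (s+i)x$ on $S$. $\mathrm{CA}(\mathbb{Z};A)$ is the monoid of all cellular automata over $A^{\mathbb{Z}}$ under composition. $\tau\in\mathrm{CA}(\mathbb{Z};A)$ is vN-regular if there exists $\sigma\in\mathrm{CA}(\mathbb{Z};A)$ (not necessarily elementary) with $\tau\sigma\tau=\tau$. An elementary cellular automaton is one with memory set $\{-1,0,1\}$. Rule $M$ ($0\leq M\leq 255$) is the elementary cellular automaton whose local function $\mu_M$ is defined as follows: let $M_1\dots M_8$ be the 8-bit binary representation of $M$ (most significant bit first) and list the elements of $A^{\{-1,0,1\}}$, written as words $(-1)x\,(0)x\,(1)x$, in lexicographically descending order $111,110,\dots,000$; then $\mu_M$ sends the $i$-th element to $M_i$. $\phi_{51}$ denotes Rule 51, which interchanges $0$'s and $1$'s; $\langle\phi_{51}\rangle=\{\mathrm{id},\phi_{51}\}$.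 For $x\in A^{\mathbb{Z}}$, $(k)x^{\mathrm{rev}}:=(-k)x$, and $(x)\tau^\star:=((x^{\mathrm{rev}})\tau)^{\mathrm{rev}}$. Two elementary cellular automata $\tau_1,\tau_2$ are equivalent if $\tau_1\in\langle\phi_{51}\rangle\tau_2\langle\phi_{51}\rangle$ or $\tau_1\in\langle\phi_{51}\rangle(\tau_2)^\star\langle\phi_{51}\rangle$. *)

(* Defs.v *)
From mathcomp Require Import all_boot all_order all_algebra.
From mathcomp Require Import finmap.

Set Implicit Arguments.
Unset Strict Implicit.
Unset Printing Implicit Defensive.

Import GRing.Theory.
Local Open Scope ring_scope.

(* The alphabet {0,1} is [bool], with 1 = [true]. *)
Definition config := int -> bool.

Definition ca_map (S : {fset int}) (mu : {ffun S -> bool} -> bool) :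
    config -> config :=
  fun x i => mu [ffun s : S => x (val s + i)].

Definition has_memory_set (S : {fset int}) (tau : config -> config) : Prop :=
  exists mu : {ffun S -> bool} -> bool, tau = ca_map mu.

Definition is_ca (tau : config -> config) : Prop :=
  exists S : {fset int}, has_memory_set S tau.

(* Maps act on the right: [ca_mul tau sigma] is first [tau], then [sigma]. *)
Definition ca_mul (tau sigma : config -> config) : config -> config :=
  fun x => sigma (tau x).

Definition vN_regular (tau : config -> config) : Prop :=
  is_ca tau /\
  exists2 sigma : config -> config,
    is_ca sigma & ca_mul (ca_mul tau sigma) tau = tau.

Definition nbhd : {fset int} := [fset -1; 0; 1]%fset.

Definition elementary (tau : config -> config) : Prop := has_memory_set nbhd tau.

Fact nbhd_left : -1 \in nbhd. Proof. by rewrite !inE. Qed.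
Fact nbhd_center : 0 \in nbhd. Proof. by rewrite !inE. Qed.
Fact nbhd_right : 1 \in nbhd. Proof. by rewrite !inE. Qed.

Definition word_of (y : {ffun nbhd -> bool}) : bool * bool * bool :=
  (y [` nbhd_left]%fset, y [` nbhd_center]%fset, y [` nbhd_right]%fset).

Definition words_desc : seq (bool * bool * bool) :=
  [:: (true, true, true);  (true, true, false);
      (true, false, true); (true, false, false);
      (false, true, true); (false, true, false);
      (false, false, true); (false, false, false)].

(* The 8-bit binary representation of M, most significant bit first. *)
Definition bits8 (M : nat) : seq bool :=
  [seq odd (M %/ 2 ^ (7 - k))%N | k <- iota 0 8].

Definition rule_local (M : nat) (y : {ffun nbhd -> bool}) : bool :=
  nth false (bits8 M) (index (word_of y) words_desc).

Definition rule (M : nat) : config -> config := ca_map (rule_local M).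

Lemma ruleE (M : nat) (x : config) (i : int) :
  rule M x i =
  nth false (bits8 M) (index (x (-1 + i), x i, x (1 + i)) words_desc).
Proof. by rewrite /rule /ca_map /rule_local /word_of !ffunE /= add0r. Qed.

Definition in_gen51 (tau : config -> config) : Prop :=
  tau = id \/ tau = rule 51.

Definition rev_config (x : config) : config := fun k => x (- k).

Definition ca_star (tau : config -> config) : config -> config :=
  fun x => rev_config (tau (rev_config x)).

Definition in_double_coset51 (tau1 tau2 : config -> config) : Prop :=
  exists alpha beta : config -> config,
    [/\ in_gen51 alpha, in_gen51 beta &
        tau1 = ca_mul (ca_mul alpha tau2) beta].

Definition equivalent_eca (tau1 tau2 : config -> config) : Prop :=
  in_double_coset51 tau1 tau2 \/ in_double_coset51 tau1 (ca_star tau2).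

(* Main.v *)
(** Rule M has an elementary generalized inverse Rule K in each case, and
    [tau sigma tau = tau] depends only on a window of seven cells.  If [sigma]
    is a generalized inverse of [tau] and [alpha], [beta] are involutions, then
    [beta sigma alpha] is one of [alpha tau beta]; likewise [sigma^*] is one of
    [tau^*]. *)
Require Import Defs.
From mathcomp Require Import all_boot all_order all_algebra.
From mathcomp Require Import finmap.
From Stdlib Require Import FunctionalExtensionality.

Set Implicit Arguments.
Unset Strict Implicit.
Unset Printing Implicit Defensive.

Import GRing.Theory.
Local Open Scope ring_scope.

(* Comparing different positions [i], [j] builds shift-equivariance into
   locality. *)
Definition is_local (tau : config -> config) : Prop :=
  exists s : seq int, forall (x y : config) (i j : int),
    {in s, forall k, x (k + i) = y (k + j)} -> tau x i = tau y j.

(** With locality, closure under composition and reversal is a computation with offsets, and no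
    local function has to be built. *)
Lemma is_caP (tau : config -> config) : is_ca tau <-> is_local tau.
Proof.
split=> [[S [mu ->]]|[s tau_loc]].
  exists (enum_fset S) => x y i j xy; rewrite /ca_map; congr mu.
  by apply/ffunP=> u; rewrite !ffunE xy //; exact: valP.
pose S := seq_fset tt s.
(* The padding value [false] is harmless: by locality, [tau (extend w) 0] depends only on the
   offsets in [s], which all lie in [S]. *)
pose extend (w : {ffun S -> bool}) : config := fun k => oapp w false (insub k).
exists S, (fun w => tau (extend w) 0).
apply: functional_extensionality => x; apply: functional_extensionality => i.
apply: tau_loc => k ks; rewrite addr0 /extend.
have kS : k \in S by rewrite seq_fsetE.
by rewrite insubT /= ffunE.
Qed.

Lemma is_ca_rule (M : nat) : is_ca (rule M).
Proof. by exists nbhd, (rule_local M). Qed.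

Lemma is_ca_id : is_ca id.
Proof.
by apply/is_caP; exists [:: 0] => x y i j /(_ 0 (mem_head _ _)); rewrite !add0r.
Qed.

Lemma is_ca_mul (tau sigma : config -> config) :
  is_ca tau -> is_ca sigma -> is_ca (ca_mul tau sigma).
Proof.
move=> /is_caP[s tau_loc] /is_caP[t sigma_loc]; apply/is_caP.
exists [seq k + l | k <- s, l <- t] => x y i j xy.
apply: sigma_loc => l lt; apply: tau_loc => k ks.
by rewrite !addrA xy // allpairs_f.
Qed.

Lemma is_ca_star (tau : config -> config) : is_ca tau -> is_ca (ca_star tau).
Proof.
move=> /is_caP[s tau_loc]; apply/is_caP.
exists [seq - k | k <- s] => x y i j xy.
apply: tau_loc => k ks; rewrite /rev_config !opprB.
by rewrite ![_ - k]addrC xy // map_f.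
Qed.

Lemma rev_configK : involutive rev_config.
Proof.
by move=> x; apply: functional_extensionality => i; rewrite /rev_config opprK.
Qed.

(** The two inner reversals cancel. *)
Lemma ca_star_mul (tau sigma : config -> config) :
  ca_star (ca_mul tau sigma) = ca_mul (ca_star tau) (ca_star sigma).
Proof.
apply: functional_extensionality => x.
by rewrite /ca_star /ca_mul rev_configK.
Qed.

Lemma vN_regular_star (tau : config -> config) :
  vN_regular tau -> vN_regular (ca_star tau).
Proof.
move=> [ca_tau [sigma ca_sigma tau_reg]]; split; first exact: is_ca_star.
by exists (ca_star sigma); [exact: is_ca_star | rewrite -!ca_star_mul tau_reg].
Qed.

Lemma vN_regular_involutive_coset (alpha beta tau : config -> config) :
  is_ca alpha -> is_ca beta -> involutive alpha -> involutive beta ->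
  vN_regular tau -> vN_regular (ca_mul (ca_mul alpha tau) beta).
Proof.
move=> ca_a ca_b aK bK [ca_tau [sigma ca_sigma tau_reg]].
split; first by do 2!apply: is_ca_mul => //.
exists (ca_mul (ca_mul beta sigma) alpha); first by do 2!apply: is_ca_mul => //.
(* The adjacent copies of [beta] and of [alpha] cancel, leaving [tau sigma tau] between [alpha] and
   [beta]. *)
apply: functional_extensionality => x; rewrite /ca_mul bK aK.
by congr beta; rewrite -[in RHS]tau_reg.
Qed.

Lemma rule51K : involutive (rule 51).
Proof.
(* The bits 00110011 of 51 negate the middle cell and ignore its neighbours. *)
have rule51E x i : rule 51 x i = ~~ x i.
  by rewrite ruleE; case: (x _) (x i) (x _) => [] [] [].
by move=> x; apply: functional_extensionality => i; rewrite !rule51E negbK.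
Qed.

Lemma in_gen51_ca (alpha : config -> config) :
  in_gen51 alpha -> is_ca alpha /\ involutive alpha.
Proof.
case=> ->; first by split; first exact: is_ca_id.
by split; [exact: is_ca_rule | exact: rule51K].
Qed.

Lemma vN_regular_double_coset51 (tau1 tau2 : config -> config) :
  in_double_coset51 tau1 tau2 -> vN_regular tau2 -> vN_regular tau1.
Proof.
move=> [alpha [beta [/in_gen51_ca[ca_a aK] /in_gen51_ca[ca_b bK] ->]]].
exact: vN_regular_involutive_coset.
Qed.

Lemma vN_regular_equivalent_eca (tau1 tau2 : config -> config) :
  equivalent_eca tau1 tau2 -> vN_regular tau2 -> vN_regular tau1.
Proof.
case=> /vN_regular_double_coset51 tau1_reg tau2_reg; apply: tau1_reg => //.
exact: vN_regular_star.
Qed.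

Definition rule_bit (M : nat) (a b c : bool) : bool :=
  nth false (bits8 M) (index (a, b, c) words_desc).

(** Three rules of radius 1 compose to radius 3: [a], ..., [g] stand for the cells [i - 3], ...,
    [i + 3], with [d] at [i]. *)
Definition inverse_bits (M K : nat) (a b c d e f g : bool) : bool :=
  rule_bit M
    (rule_bit K (rule_bit M a b c) (rule_bit M b c d) (rule_bit M c d e))
    (rule_bit K (rule_bit M b c d) (rule_bit M c d e) (rule_bit M d e f))
    (rule_bit K (rule_bit M c d e) (rule_bit M d e f) (rule_bit M e f g))
  == rule_bit M c d e.

Lemma rule_inverse (M K : nat) :
  (forall a b c d e f g, inverse_bits M K a b c d e f g) ->
  ca_mul (ca_mul (rule M) (rule K)) (rule M) = rule M.
Proof.
move=> inv_MK; apply: functional_extensionality => x.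
apply: functional_extensionality => i.
(* Opposite shifts cancel, so overlapping windows name each shared cell by the same term. *)
rewrite /ca_mul !ruleE !(addKr, addNKr).
exact/eqP/inv_MK.
Qed.

(* Pairs [(M, K)] with Rule K a generalized inverse of Rule M.  Rules 204, 240
   and 85 are the identity, [x i := x (i - 1)] and [x i := ~~ x (i + 1)]; the
   others were found by a search over all local functions on {-1, 0, 1}. *)
Definition inverse_table : seq (nat * nat) :=
  [:: (0, 0); (2, 240); (4, 204); (5, 5); (10, 240); (11, 85); (12, 204);
      (13, 21); (14, 85); (15, 85); (29, 29); (35, 49); (43, 113); (51, 51);
      (76, 204); (128, 254); (192, 238); (200, 204)]%N.

Lemma inverse_tableP (M K : nat) (a b c d e f g : bool) :
  (M, K) \in inverse_table -> inverse_bits M K a b c d e f g.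
Proof.
have/allP inv_all :
    all (fun p => inverse_bits p.1 p.2 a b c d e f g) inverse_table.
  (* Each of the 128 windows leaves a closed boolean test of all 18 pairs. *)
  by case: a b c d e f g => [] [] [] [] [] [] []; vm_compute.
exact: inv_all (M, K).
Qed.

Theorem lemma3 (M : nat)
    (hM : M \in [:: 0; 2; 4; 5; 10; 11; 12; 13; 14; 15; 29; 35; 43; 51; 76;
                    128; 192; 200]%N)
    (tau : config -> config) (htau : elementary tau)
    (heq : equivalent_eca tau (rule M)) :
  vN_regular tau.
Proof.
apply: (vN_regular_equivalent_eca heq); split; first exact: is_ca_rule.
(* The first components of the table compute to the list in [hM]. *)
have /mapP[[N K] NK /= ->] : M \in map fst inverse_table by [].
exists (rule K); first exact: is_ca_rule.
by apply: rule_inverse => *; exact: inverse_tableP.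
Qed.
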